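(* For any integer $d\ge 2$, every finite simple connected $2d$-regular graph admits an antimagic orientation.
   Context: A labeling of a digraph $D$ with $m$ arcs is a bijection from the set of arcs of $D$ to $\{1,2,\dots,m\}$. For a labeling, the vertex-sum of a vertex $u$ is the sum of the labels of all arcs entering $u$ minus the sum of the labels of all arcs leaving $u$. A labeling is antimagic if no two distinct vertices have the same vertex-sum. An orientation $D$ of a graph $G$ is antimagic if $D$ has an antimagic labeling; $G$ admits an antimagic orientation if some orientation of $G$ is antimagic. *)

(* Defs.v *)
From mathcomp Require Import all_boot all_order all_algebra.

Set Implicit Arguments.
Unset Strict Implicit.
Unset Printing Implicit Defensive.

Import GRing.Theory.

Section Graphs.

Variable T : finType.

(* A graph on the vertex set T is given by its adjacency relation e. *)

Definition simple_graph (e : rel T) : Prop := symmetric e /\ irreflexive e.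

Definition connected_graph (e : rel T) : Prop :=
  0 < #|T| /\ forall u v : T, connect e u v.

Definition regular_graph (k : nat) (e : rel T) : Prop :=
  forall v : T, #|[set u | e v u]| = k.

(* A digraph on T is a relation D: there is an arc from u to v iff D u v. *)

Definition arcs (D : rel T) : {set T * T} := [set a | D a.1 a.2].

Definition orientation (e D : rel T) : Prop :=
  forall u v : T, (D u v || D v u) = e u v /\ ~~ (D u v && D v u).

(* Only the values of l on arcs D matter: l restricts to a bijection from
   arcs D onto {1, ..., #|arcs D|}. *)
Definition labeling (D : rel T) (l : T * T -> nat) : Prop :=
  {in arcs D &, injective l} /\
  forall k : nat, 1 <= k <= #|arcs D| <-> exists2 a, a \in arcs D & l a = k.

Definition vertex_sum (D : rel T) (l : T * T -> nat) (u : T) : int :=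
  (\sum_(a in arcs D | a.2 == u) (l a)%:Z
   - \sum_(a in arcs D | a.1 == u) (l a)%:Z)%R.

Definition antimagic_labeling (D : rel T) (l : T * T -> nat) : Prop :=
  labeling D l /\ injective (vertex_sum D l).

Definition antimagic (D : rel T) : Prop :=
  exists l : T * T -> nat, antimagic_labeling D l.

Definition has_antimagic_orientation (e : rel T) : Prop :=
  exists D : rel T, orientation e D /\ antimagic D.

End Graphs.

(* Main.v *)
Require Import Defs.
From mathcomp Require Import all_boot all_order all_algebra.
From mathcomp Require Import zify.

(** Follow an Euler tour and, for every vertex (all but one of them if their
    number is odd), mark one visit of the tour; evenly many marks cut the
    cyclic tour into runs, which are directed alternately along and against
    the tour.  Each run receives an interval of consecutive labels, increasing
    along its direction.  An unmarked visit then contributes -1 to its vertex,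
    and a marked visit contributes plus or minus the sum of the two labels
    meeting there, so that a marked vertex has sum -(d-1) +/- (that sum) and
    the unmarked one -d.  It remains to order the runs so that, among marks of
    the same sign, these sums are distinct: arrange the ranks around the cycle
    as 0, 2, 4, ..., 5, 3, 1; then the pairs of ranks of neighbouring runs are
    totally ordered componentwise. *)

Set Implicit Arguments.
Unset Strict Implicit.
Unset Printing Implicit Defensive.

Import GRing.Theory.

(* The predecessor of [i] modulo [m]. *)
Definition cpred (m i : nat) : nat := if i == 0 then m.-1 else i.-1.

(** * The zigzag arrangement 0, 2, 4, ..., 5, 3, 1 of ranks around a cycle *)

Definition zigzag (r j : nat) : nat :=
  if j.*2 < r then j.*2 else (r - j).*2.-1.

Lemma zigzag_inj r i j : i < r -> j < r -> zigzag r i = zigzag r j -> i = j.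
Proof. rewrite /zigzag; do 2 case: ifP; lia. Qed.

(** For [r] even, the pairs at distinct positions of equal parity are disjoint, which makes the
    comparison strict. The crosswise alternatives are needed because a pair may be ascending or
    descending along the cycle. *)
Lemma zigzag_adjacent r i j : ~~ odd r -> i < r -> j < r -> i != j ->
    odd i = odd j ->
  let p := zigzag r (cpred r i) in let q := zigzag r i in
  let p' := zigzag r (cpred r j) in let q' := zigzag r j in
  [|| (p < p') && (q < q'), (p < q') && (q < p'),
      (p' < p) && (q' < q) | (q' < p) && (p' < q)].
Proof.
rewrite /zigzag /cpred => er ir jr.
rewrite -(odd_double_half i) -(odd_double_half j) -(odd_double_half r) in ir jr *.
rewrite (negbTE er) add0n in ir jr *.
move: (odd i) (odd j) i./2 j./2 r./2 ir jr => b b' {er}a a' h ir jr.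
rewrite !oddD !odd_double !addbF !oddb => nij bE; rewrite -{b'}bE in jr nij *.
case: b ir jr nij => /= ir jr nij.
  by repeat case: ifP => ?; lia.
(* Only an even position can be 0, where [cpred] wraps around. *)
case: a ir nij => [|a] ir nij; case: a' jr nij => [|a'] jr nij //=;
repeat (case: ifP => ?).
all: lia.
Qed.

(** * Ranks of distinct keys *)

Section Rank.

Variables (m : nat) (K : nat -> nat).
Hypothesis K_inj : forall i j, i < m -> j < m -> K i = K j -> i = j.

Definition rank (i : nat) : nat := #|[set k : 'I_m | K k <= K i]|.

Lemma rank_bounds i : i < m -> 0 < rank i <= m.
Proof.
move=> im; rewrite /rank; apply/andP; split.
  by apply/card_gt0P; exists (Ordinal im); rewrite inE.
by rewrite -[X in _ <= X]card_ord max_card.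
Qed.

Lemma rank_lt i j : j < m -> K i < K j -> rank i < rank j.
Proof.
move=> jm ij; apply/proper_card/properP; split.
  by apply/subsetP => k; rewrite !inE; lia.
by exists (Ordinal jm); rewrite !inE //= -ltnNge.
Qed.

Lemma rank_inj i j : i < m -> j < m -> rank i = rank j -> i = j.
Proof.
move=> im jm eq_ij; apply: K_inj => //.
by case: (ltngtP (K i) (K j)) => // /rank_lt; [move/(_ jm) | move/(_ im)]; lia.
Qed.

(** No key lies strictly between consecutive integers, and by injectivity only [i] has the key
    [K i], so the counted set grows by [i] alone. *)
Lemma rankS i j : i < m -> K i = (K j).+1 -> rank i = (rank j).+1.
Proof.
move=> im Kij; rewrite /rank.
have -> : [set k : 'I_m | K k <= K i]
        = Ordinal im |: [set k : 'I_m | K k <= K j].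
  apply/setP => k; rewrite !inE -val_eqE /=.
  have [->|ki] := eqVneq (k : nat) i; first by rewrite leqnn.
  have : K k != K i by apply: contra ki => /eqP /K_inj ->.
  by lia.
by rewrite cardsU1 inE /= Kij ltnn.
Qed.

End Rank.

(** * Labels and directions along a cyclic tour with marked visits *)

Definition signed (s : bool) (n : nat) : int := (if s then n%:Z else - n%:Z)%R.

(** Edge [i] leaves visit [i] and edge [cpred m i] enters it; [S] marks visits, and [sg i] tells
    whether edge [i] is directed along the tour. Marking visit 0 makes every run an interval of
    indices. *)
Lemma switch_labels (m : nat) (S : pred nat) :
    0 < m -> S 0 -> ~~ odd (count S (iota 0 m)) ->
  exists (L : nat -> nat) (sg : nat -> bool),
  [/\ forall i, i < m -> 0 < L i <= m,
      forall i j, i < m -> j < m -> L i = L j -> i = j,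
      forall i, i < m -> ~~ S i ->
        (signed (sg (cpred m i)) (L (cpred m i)) - signed (sg i) (L i) = -1)%R,
      forall i, i < m -> S i -> sg (cpred m i) = ~~ sg i &
      forall i j, i < m -> j < m -> S i -> S j -> sg i = sg j ->
        L (cpred m i) + L i = L (cpred m j) + L j -> i = j].
Proof.
move=> m0 S0; set r := count S (iota 0 m) => er.
(* The number of the run containing edge [i], counted from 0. *)
pose run i := (count S (iota 0 i.+1)).-1.
(* Sorting edges by [K] lists the runs by rank, each run along its direction. *)
pose K i := zigzag r (run i) * m + if odd (run i) then m.-1 - i else i.
have cntS i : count S (iota 0 i.+1) = count S (iota 0 i) + S i.
  by rewrite -addn1 iotaD count_cat /= addn0.
have cnt0 i : 0 < count S (iota 0 i.+1) by rewrite /= S0.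
have cnt_le i j : i <= j -> count S (iota 0 i) <= count S (iota 0 j).
  by move=> ij; rewrite -(subnKC ij) iotaD count_cat leq_addr.
have run0 : run 0 = 0 by rewrite /run /= S0.
have runS i : run i.+1 = run i + S i.+1.
  by rewrite /run cntS; have := cnt0 i; lia.
have run_lt i : i < m -> run i < r.
  by move=> im; rewrite /run; have := cnt_le _ _ im; have := cnt0 i; rewrite -/r; lia.
have run_last : run m.-1 = r.-1 by rewrite /run prednK.
have run_inj i j : S i -> S j -> run i = run j -> i = j.
  wlog ij : i j / i < j => [th Si Sj eq_ij|Si Sj].
    by case: (ltngtP i j) => // ij; [|symmetry]; apply: th.
  have := cnt_le _ _ ij; rewrite /run (cntS j) Sj.
  by have := cnt0 i; lia.
have run_cpred i : i < m -> S i -> run (cpred m i) = cpred r (run i).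
  case: i => [|i] im Si; first by rewrite run0 /cpred /= run_last.
  by rewrite /cpred /= runS Si addn1.
(* Each rank owns a block of [m] keys, and offsets in a block stay below [m]. *)
have K_zz i j : i < m -> j < m -> zigzag r (run i) < zigzag r (run j) -> K i < K j.
  move=> im jm zz; rewrite /K.
  have : zigzag r (run i) * m + m <= zigzag r (run j) * m by nia.
  by do 2 case: ifP; lia.
have K_inj i j : i < m -> j < m -> K i = K j -> i = j.
  move=> im jm eqK.
  case: (ltngtP (zigzag r (run i)) (zigzag r (run j))) => zz.
  - by have := K_zz _ _ im jm zz; lia.
  - by have := K_zz _ _ jm im zz; lia.
  - have := zigzag_inj (run_lt _ im) (run_lt _ jm) zz => eq_run.
    by move: eqK; rewrite /K eq_run; case: ifP; lia.
have cpred_lt i : i < m -> cpred m i < m by rewrite /cpred; case: ifP; lia.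
have Llt i j : zigzag r (run i) < zigzag r (run j) -> i < m -> j < m ->
    rank m K i < rank m K j.
  by move=> zz im jm; apply: rank_lt => //; apply: K_zz.
exists (rank m K), (fun i => ~~ odd (run i)); split => //.
- exact: rank_bounds.
- exact: rank_inj.
- case => [|i] im nS; first by rewrite S0 in nS.
  have eq_run : run i.+1 = run i by rewrite runS (negbTE nS) addn0.
  (* In a reversed run the labels fall along the tour but carry negative signs, so the difference is
     -1 in both cases. *)
  rewrite /cpred /= eq_run; case odd_run: (odd (run i)).
    have -> : rank m K i = (rank m K i.+1).+1.
      by apply: rankS; rewrite ?/K ?eq_run ?odd_run //; lia.
    by rewrite /signed /=; lia.
  have -> : rank m K i.+1 = (rank m K i).+1.
    by apply: rankS => //; rewrite /K eq_run odd_run addnS.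
  by rewrite /signed /=; lia.
(* Parity alternates also from the last run to run 0, because [r] is even. *)
- move=> i im Si; rewrite run_cpred // /cpred; have := run_lt _ im.
  by case: ifP; lia.
move=> i j im jm Si Sj odd_ij eq_sum; apply/eqP; apply/negP => nij.
have nrun : run i != run j by apply/eqP => /run_inj ij; case: nij; apply/eqP/ij.
(* Equal signs mean run numbers of equal parity, so the two labels at one mark are dominated by
   those at the other and the sums differ. *)
have := zigzag_adjacent er (run_lt _ im) (run_lt _ jm) nrun.
rewrite -!run_cpred // => /(_ (negb_inj odd_ij))/or4P.
have [ci cj] := (cpred_lt _ im, cpred_lt _ jm).
by case=> /andP[/Llt lt1 /Llt lt2]; lia.
Qed.


(** * Euler tours *)

Section EulerTour.

Variables (T : finType) (e : rel T).
Hypotheses (e_sym : symmetric e) (e_irr : irreflexive e).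

(** Unordered, so that a [trail] cannot reuse an edge in either direction. *)
Definition edge (u v : T) : {set T} := [set u; v].

Definition trail (x : T) (s : seq T) : bool :=
  path e x s && uniq (pairmap edge x s).

Lemma edgeC u v : edge u v = edge v u.
Proof. exact: setUC. Qed.

Lemma edge_eq u v u' v' : edge u v = edge u' v' ->
  (u = u' /\ v = v') \/ (u = v' /\ v = u').
Proof.
move=> eq_uv.
have /set2P u_in : u \in edge u' v' by rewrite -eq_uv set21.
have /set2P v_in : v \in edge u' v' by rewrite -eq_uv set22.
have /set2P u'_in : u' \in edge u v by rewrite eq_uv set21.
have /set2P v'_in : v' \in edge u v by rewrite eq_uv set22.
by case: u_in u'_in v_in v'_in => ? [] ? [] ? [] ?; subst; auto.
Qed.

Lemma edge_inj u : injective (edge u).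
Proof. by move=> v v' /edge_eq[[_ ->] | [-> ->]]. Qed.

Lemma path_edge x s A : path e x s -> A \in pairmap edge x s ->
  exists u v, [/\ e u v, A = edge u v, u \in x :: s & v \in x :: s].
Proof.
elim: s x => [|y s IH] x //= /andP[exy ps]; rewrite inE => /predU1P[->|].
  by exists x, y; rewrite !inE !eqxx orbT.
case/(IH _ ps) => u [v [euv -> us vs]]; exists u, v.
by rewrite inE us orbT inE vs orbT.
Qed.

Lemma count_edge x s v : path e x s ->
  count (fun A : {set T} => v \in A) (pairmap edge x s)
    = count_mem v (belast x s) + count_mem v s.
Proof.
elim: s x => [|y s IH] x //= /andP[exy /IH ->]; rewrite !inE.
have : ~~ ((x == v) && (y == v)).
  by apply/negP => /andP[/eqP xv /eqP yv]; rewrite xv yv e_irr in exy.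
by rewrite (eq_sym v x) (eq_sym v y) /=; case: (x == v); case: (y == v); lia.
Qed.

Lemma count_belast (x : T) s v :
  count_mem v (belast x s) + (last x s == v) = (x == v) + count_mem v s.
Proof.
have : count_mem v (x :: s) = count_mem v (rcons (belast x s) (last x s)).
  by rewrite -lastI.
by rewrite -cats1 count_cat /= addn0.
Qed.

Lemma trail_degree x s v : trail x s ->
    (forall u, e v u -> edge v u \in pairmap edge x s) ->
  count (fun A : {set T} => v \in A) (pairmap edge x s) = #|[set u | e v u]|.
Proof.
case/andP=> ps us all_v; rewrite -size_filter cardE -(size_map (edge v)).
apply: perm_size; apply: uniq_perm.
- exact: filter_uniq.
- by rewrite map_inj_uniq ?enum_uniq //; apply: edge_inj.
move=> A; rewrite mem_filter; apply/andP/mapP => [[vA sA] | [u]].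
  have [a [b [eab AE _ _]]] := path_edge ps sA.
  move: vA; rewrite AE !inE => /orP[]/eqP ->.
    by exists b; rewrite ?mem_enum ?inE.
  by exists a; rewrite 1?edgeC // mem_enum inE e_sym.
by rewrite mem_enum inE => evu ->; rewrite !inE eqxx all_v.
Qed.

(** A longest trail uses every edge at its start. Parity then closes it, rotation makes each of its
    vertices a start, and connectivity puts all vertices on it. *)
Lemma euler_trail (v0 : T) : (forall u v, connect e u v) ->
    (forall v, ~~ odd #|[set u | e v u]|) ->
  exists x s, [/\ trail x s, last x s = x &
    forall u v, e u v -> edge u v \in pairmap edge x s].
Proof.
move=> e_conn e_even.
pose P n := [exists x, exists s : n.-tuple T, trail x s].
have exP : exists n, P n.
  by exists 0; apply/existsP; exists v0; apply/existsP; exists [tuple].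
have boundP n : P n -> n <= #|{set T}|.
  case/existsP => x /existsP[s /andP[_ us]].
  rewrite -(size_tuple s) -(size_pairmap edge x) -(card_uniqP us).
  exact: max_card.
case: (ex_maxnP exP boundP) => n /existsP[x /existsP[s tr_s]] max_n.
have saturated u t v : trail u t -> size t = n -> e u v ->
    edge u v \in pairmap edge u t.
  move=> /andP[pt ut] sz euv; apply: contraT => nuv.
  have /max_n : P n.+1; last by rewrite ltnn.
  apply/existsP; exists v; apply/existsP.
  have sz' : size (u :: t) == n.+1 by rewrite /= sz.
  by exists (Tuple sz'); rewrite /trail /= e_sym euv pt edgeC nuv ut.
have size_s := size_tuple s.
move: (tval s) tr_s size_s => {}s tr_s size_s.
have [ps us] := andP tr_s.
(* An open trail has an odd number of edges at its start, yet these are all the edges there, evenly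
   many. *)
have closed_s : last x s = x.
  have := trail_degree tr_s (fun u => saturated _ _ u tr_s size_s).
  have := count_belast x s x; rewrite eqxx (count_edge _ ps) => cb cd.
  by have := e_even x; rewrite -cd; case: eqP cb => //; lia.
have covered u v : u \in x :: s -> e u v -> edge u v \in pairmap edge x s.
  move=> us_ euv; case/splitPl: us_ ps us size_s closed_s => s1 s2 lu.
  rewrite cat_path last_cat pairmap_cat lu => /andP[p1 p2] uq sz l2.
  (* Rotating the closed trail to start at [u] keeps its edges and length, so maximality applies at
     [u]. *)
  have perm12 : perm_eq (pairmap edge u (s2 ++ s1))
      (pairmap edge x s1 ++ pairmap edge u s2).
    by rewrite pairmap_cat l2 perm_catC.
  rewrite -(perm_mem perm12); apply: (saturated) => //.
    by rewrite /trail cat_path l2 p2 p1 (perm_uniq perm12).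
  by rewrite size_cat addnC -size_cat.
exists x, s; split => // u v euv; apply: (covered) => //.
have clos : closed e [in x :: s].
  apply: intro_closed; first exact: sym_connect_sym.
  move=> a b eab a_s.
  have [a' [b' [_ ab' a's b's]]] := path_edge ps (covered _ _ a_s eab).
  by case: (edge_eq ab') => -[_ ->].
by have := closed_connect clos (e_conn x u); rewrite !inE eqxx => <-.
Qed.

Lemma euler_tour (v0 : T) : (forall u v, connect e u v) ->
    (forall v, ~~ odd #|[set u | e v u]|) ->
  exists (m : nat) (w : nat -> T),
  [/\ w m = w 0,
      forall i, i < m -> e (w i) (w i.+1),
      forall i j, i < m -> j < m ->
        edge (w i) (w i.+1) = edge (w j) (w j.+1) -> i = j,
      forall u v, e u v -> exists2 i, i < m & edge (w i) (w i.+1) = edge u v &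
      forall v, (\sum_(i < m) (w i == v)).*2 = #|[set u | e v u]|].
Proof.
move=> e_conn e_even; have [x [s [tr_s l_s cov]]] := euler_trail v0 e_conn e_even.
have [ps us] := andP tr_s.
have nthE i : i < size s ->
    nth set0 (pairmap edge x s) i = edge (nth x (x :: s) i) (nth x (x :: s) i.+1).
  by move=> im; rewrite (nth_pairmap x).
exists (size s), (nth x (x :: s)); split.
- by rewrite -[X in nth x (x :: s) X]/((size (x :: s)).-1) nth_last.
- by move=> i im; apply: (pathP x ps).
- move=> i j im jm; rewrite -!nthE // => /eqP.
  by rewrite nth_uniq ?size_pairmap // => /eqP.
- move=> u v /cov /(nthP set0)[i]; rewrite size_pairmap => im <-.
  by exists i; rewrite ?nthE.
(* On a closed trail a vertex starts as many edges as it ends, so its degree is twice its number of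
   visits. *)
move=> v; rewrite -(trail_degree tr_s (cov v)) count_edge //.
have := count_belast x s v; rewrite l_s addnC => /addnI ->; rewrite -addnn.
have -> // : \sum_(i < size s) (nth x (x :: s) i == v) = count_mem v s.
have := count_belast x s v; rewrite l_s addnC => /addnI <-.
rewrite -sum1_count (big_nth x) size_belast big_mkord [RHS]big_mkcond.
apply: eq_bigr => i _; rewrite lastI nth_rcons size_belast ltn_ord /=.
by case: ifP.
Qed.

End EulerTour.

(** * Vertex sums of an oriented tour *)

Lemma sum_cpred (R : nmodType) (T : eqType) (m : nat) (w : nat -> T)
    (F : T -> nat -> R) : w m = w 0 ->
  (\sum_(i < m) F (w i.+1) i = \sum_(i < m) F (w i) (cpred m i))%R.
Proof.
case: m => [|m] wm; first by rewrite !big_ord0.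
by rewrite big_ord_recr big_ord_recl /= wm addrC.
Qed.

Section OrientedTour.

Variables (T : finType) (e : rel T) (m : nat) (w : nat -> T).
Variables (L : nat -> nat) (sg : nat -> bool).
Hypotheses (e_sym : symmetric e) (e_irr : irreflexive e).
Hypothesis w_closed : w m = w 0.
Hypothesis w_edge : forall i, i < m -> e (w i) (w i.+1).
Hypothesis w_inj : forall i j, i < m -> j < m ->
  edge (w i) (w i.+1) = edge (w j) (w j.+1) -> i = j.
Hypothesis w_cover : forall u v, e u v ->
  exists2 i, i < m & edge (w i) (w i.+1) = edge u v.
Hypothesis L_bounds : forall i, i < m -> 0 < L i <= m.
Hypothesis L_inj : forall i j, i < m -> j < m -> L i = L j -> i = j.

Definition arc (i : 'I_m) : T * T :=
  if sg i then (w i, w i.+1) else (w i.+1, w i).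

Definition arc_rel : rel T := fun u v => [exists i, arc i == (u, v)].

Definition arc_label (a : T * T) : nat :=
  if [pick i | arc i == a] is Some i then L i else 0.

Lemma arc_edge i : edge (arc i).1 (arc i).2 = edge (w i) (w i.+1).
Proof. by rewrite /arc; case: (sg i) => //=; rewrite edgeC. Qed.

Lemma arc_inj : injective arc.
Proof.
move=> i j eq_ij; apply/val_inj/w_inj; [exact: ltn_ord | exact: ltn_ord |].
by rewrite /= -!arc_edge eq_ij.
Qed.

Lemma arcsE : arcs arc_rel = [set arc i | i : 'I_m].
Proof.
apply/setP => -[u v]; rewrite inE /=; apply/existsP/imsetP => -[i].
  by move/eqP <-; exists i.
by move=> _ ->; exists i.
Qed.

Lemma arc_labelE i : arc_label (arc i) = L i.
Proof.
rewrite /arc_label; case: pickP => [j /eqP/arc_inj -> //|/(_ i)].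
by rewrite eqxx.
Qed.

Lemma arc_orientation : orientation e arc_rel.
Proof.
have arc_e i u v : arc i = (u, v) -> e u v.
  move=> iuv; have := w_edge (ltn_ord i); move: iuv; rewrite /arc.
  by case: (sg i) => -[-> ->] //; rewrite e_sym.
move=> u v; split.
  apply/orP/idP => [[]/existsP[i /eqP/arc_e] //|/w_cover[i im]].
    by rewrite e_sym.
  rewrite -[i]/(val (Ordinal im)) -arc_edge; set k := Ordinal im.
  case/edge_eq => -[uE vE]; [left | right]; apply/existsP; exists k.
    by rewrite -uE -vE -surjective_pairing.
  by rewrite -uE -vE -surjective_pairing.
apply/negP => /andP[/existsP[i /eqP iuv] /existsP[j /eqP jvu]].
have ij : i = j.
  apply/val_inj/w_inj; [exact: ltn_ord | exact: ltn_ord |].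
  by rewrite /= -!arc_edge iuv jvu /= edgeC.
move: jvu; rewrite -ij iuv => -[uv _].
by move: (arc_e _ _ _ iuv); rewrite uv e_irr.
Qed.

Lemma arc_labeling : labeling arc_rel arc_label.
Proof.
rewrite /labeling arcsE card_imset ?card_ord; last exact: arc_inj.
split=> [_ _ /imsetP[i _ ->] /imsetP[j _ ->]|k].
  by rewrite !arc_labelE => /(L_inj (ltn_ord i) (ltn_ord j))/val_inj ->.
split=> [km | [_ /imsetP[i _ ->] <-]]; last by rewrite arc_labelE L_bounds.
(* [L] lowered by one is an injective self-map of ['I_m], hence onto. *)
have pL (i : 'I_m) : (L i).-1 < m by have := L_bounds (ltn_ord i); lia.
have f_inj : injective (fun i => Ordinal (pL i)).
  move=> i j [eq_ij]; apply/val_inj/L_inj; [exact: ltn_ord | exact: ltn_ord |].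
  by have := L_bounds (ltn_ord i); have := L_bounds (ltn_ord j); rewrite /=; lia.
have km' : k.-1 < m by lia.
have /codomP[i /(congr1 val) /= ki] := injF_onto f_inj (Ordinal km').
exists (arc i); first exact: imset_f.
by rewrite arc_labelE; have := L_bounds (ltn_ord i); lia.
Qed.

Definition visit_sum (i : nat) : int :=
  (signed (sg (cpred m i)) (L (cpred m i)) - signed (sg i) (L i))%R.

(** Whichever way edge [i] is directed, it adds its signed label at [w i.+1] and subtracts it at
    [w i]; a cyclic shift regroups these terms by visit. *)
Lemma vertex_sum_visits u :
  vertex_sum arc_rel arc_label u = (\sum_(i < m | w i == u) visit_sum i)%R.
Proof.
have sum_arcs (P : pred (T * T)) :
    (\sum_(a in arcs arc_rel | P a) (arc_label a)%:Z
      = \sum_(i < m) if P (arc i) then (L i)%:Z else 0)%R.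
  rewrite arcsE big_mkcondr big_imset /=; last by move=> i j _ _; apply: arc_inj.
  by apply: eq_big => // i _; rewrite arc_labelE.
pose F v i := (if v == u then signed (sg i) (L i) else 0)%R.
rewrite /vertex_sum !sum_arcs -sumrB [RHS]big_mkcond /=.
transitivity (\sum_(i < m) (F (w i.+1) i - F (w i) i))%R.
  apply: eq_bigr => i _; rewrite /F /arc /signed.
  by case: (sg i) => /=; do 2 case: eqP => _; lia.
rewrite sumrB sum_cpred // -sumrB; apply: eq_bigr => i _.
by rewrite /F /visit_sum; case: eqP.
Qed.

End OrientedTour.

(** * Choice of the marked visits *)

(** Supplies the vertices to be marked: all or, in odd order, all but [y]. Keeping [x] allows the
    initial visit of the tour to be marked. *)
Lemma even_set_missing (T : finType) (x y : T) : x != y ->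
  exists X : {set T}, [/\ x \in X, ~~ odd #|X| &
    forall u v, u \notin X -> v \notin X -> u = v].
Proof.
move=> xy; case odd_T : (odd #|T|); last first.
  by exists setT; rewrite cardsT odd_T; split => // u v; rewrite inE.
exists [set~ y]; split; first by rewrite !inE.
  by have := cardsC1 y; move: odd_T; lia.
by move=> u v; rewrite !inE !negbK => /eqP -> /eqP ->.
Qed.

Definition first_visit (T : finType) (m : nat) (w : nat -> T) (X : {set T}) :=
  [pred i | (w i \in X) && (index (w i) (mkseq w m) == i)].

Section FirstVisit.

Variables (T : finType) (m : nat) (w : nat -> T) (X : {set T}).
Hypothesis visited : forall v, exists2 i, i < m & w i = v.

Let visit_pos (v : T) : nat := index v (mkseq w m).

Lemma mem_visited v : v \in mkseq w m.
Proof. by have [i im <-] := visited v; rewrite map_f // mem_iota. Qed.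

Lemma visit_pos_lt v : visit_pos v < m.
Proof. by rewrite -[X in _ < X](size_mkseq w m) index_mem mem_visited. Qed.

Lemma visit_posK v : w (visit_pos v) = v.
Proof.
by rewrite -(nth_mkseq v w (visit_pos_lt v)) nth_index ?mem_visited.
Qed.

Lemma first_visit_pos v : v \in X -> first_visit m w X (visit_pos v).
Proof. by move=> vX /=; rewrite visit_posK vX eqxx. Qed.

Lemma count_first_visit : count (first_visit m w X) (iota 0 m) = #|X|.
Proof.
rewrite -size_filter cardE -(size_map w); apply/perm_size/uniq_perm.
- rewrite map_inj_in_uniq ?filter_uniq ?iota_uniq // => i j.
  rewrite !mem_filter => /andP[/andP[_ /eqP iE] _] /andP[/andP[_ /eqP jE] _].
  by move=> wij; rewrite -iE wij.
- exact: enum_uniq.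
move=> v; rewrite mem_enum; apply/mapP/idP => [[i] | vX].
  by rewrite mem_filter => /andP[/andP[iX _] _] ->.
exists (visit_pos v); last by rewrite visit_posK.
by rewrite mem_filter first_visit_pos // mem_iota visit_pos_lt.
Qed.

(** A vertex of [X] has exactly one marked visit, so one term survives. *)
Lemma sum_first_visit (F : nat -> int) v :
  (\sum_(i < m | w i == v) (if first_visit m w X i then F i else 0)
    = if v \in X then F (visit_pos v) else 0)%R.
Proof.
rewrite -big_mkcondr /=; case: ifP => vX.
  rewrite (big_pred1 (Ordinal (visit_pos_lt v))) // => i.
  rewrite /= -val_eqE /=; apply/idP/eqP => [/and3P[/eqP wi _ /eqP iE]|iE]; first by rewrite -iE wi.
  by rewrite iE visit_posK vX !eqxx.
by apply: big1 => i /and3P[/eqP ->]; rewrite vX.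
Qed.

End FirstVisit.

(** * The antimagic orientation *)

Theorem theorem3p1 (d : nat) (hd : 2 <= d) (T : finType) (e : rel T)
    (e_simple : simple_graph e) (e_conn : connected_graph e)
    (e_reg : regular_graph (2 * d) e) :
  has_antimagic_orientation e.
Proof.
case: e_simple e_conn => e_sym e_irr [/card_gt0P[v0 _] e_conn].
have e_even v : ~~ odd #|[set u | e v u]| by rewrite e_reg mul2n odd_double.
have [m [w [w_closed w_edge w_inj w_cover w_deg]]] :=
  euler_tour e_sym e_irr v0 e_conn e_even.
have visits v : \sum_(i < m) (w i == v) = d.
  by have := w_deg v; rewrite e_reg; lia.
have visited v : exists2 i, i < m & w i = v.
  have [i /eqP iv | none] := pickP (fun i : 'I_m => w i == v); first by exists i.
  by have := visits v; rewrite big1 => [|i _]; [lia | rewrite none].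
have m0 : 0 < m by have [i im _] := visited v0; lia.
(* Visit 0 must be marked, so the vertex that may be left out is [w 1]. *)
have w01 : w 0 != w 1.
  by apply/eqP => w01; have := w_edge _ m0; rewrite -w01 e_irr.
have [X [X0 evenX X_missing]] := even_set_missing w01.
pose S := first_visit m w X.
have S0 : S 0 by rewrite /S /= X0 -(prednK m0) /= eqxx.
have even_S : ~~ odd (count S (iota 0 m)) by rewrite count_first_visit.
have [L [sg [L_bounds L_inj L_pass L_switch L_distinct]]] :=
  switch_labels m0 S0 even_S.
exists (arc_rel m w sg); split; first exact: arc_orientation.
exists (arc_label m w L sg); split; first exact: arc_labeling.
pose c i := visit_sum m L sg i.
pose pos v := index v (mkseq w m).
have pos_lt v : pos v < m by apply: visit_pos_lt.
(* Each of the [d] visits counts as -1, and the marked one is corrected by [c + 1]. *)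
have vsE v : vertex_sum (arc_rel m w sg) (arc_label m w L sg) v
    = ((if v \in X then c (pos v) + 1 else 0) - d%:Z)%R.
  rewrite vertex_sum_visits // -(sum_first_visit X visited (fun i => c i + 1)%R).
  have -> : (d%:Z = \sum_(i < m | w i == v) 1)%R.
    by rewrite -natz -(visits v) natr_sum [RHS]big_mkcond; apply: eq_bigr => i _; case: eqP.
  rewrite -sumrB; apply: eq_bigr => i _; case: ifP => [_|/negbT nS].
    by rewrite addrK.
  by rewrite /visit_sum L_pass ?sub0r.
have cE v : v \in X -> c (pos v) =
    signed (~~ sg (pos v)) (L (cpred m (pos v)) + L (pos v)).
  move=> vX; rewrite /c /visit_sum L_switch //; last exact: first_visit_pos.
  by rewrite /signed; case: (sg _) => /=; lia.
(* Two positive labels meet at a mark, so [c] is at least 2 in absolute value and no marked vertex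
   has sum [-d]. *)
have c_ne v : v \in X -> (c (pos v) != -1)%R.
  move=> vX; rewrite cE // /signed.
  have := L_bounds _ (pos_lt v).
  have : cpred m (pos v) < m by have := pos_lt v; rewrite /cpred; case: ifP; lia.
  by move/L_bounds; case: (sg _) => /=; lia.
move=> u v; rewrite !vsE => /addIr.
case: ifP => uX; case: ifP => vX.
- move/addIr => eq_c.
  apply: (can_inj (visit_posK visited)); rewrite -/(pos u) -/(pos v).
  have := L_bounds _ (pos_lt u); have := L_bounds _ (pos_lt v).
  move: eq_c; rewrite !cE // /signed => eq_c Lu Lv.
  (* Label sums are positive, so equal values of [c] have equal signs and equal label sums. *)
  apply: L_distinct; rewrite ?pos_lt //; try exact: first_visit_pos.
    by move: eq_c; do 2 case: (sg _) => /=; lia.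
  by move: eq_c; do 2 case: (sg _) => /=; lia.
- by move/eqP; rewrite addr_eq0 (negbTE (c_ne _ uX)).
- by move/esym/eqP; rewrite addr_eq0 (negbTE (c_ne _ vX)).
- by move=> _; apply: X_missing; rewrite ?uX ?vX.
Qed.
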